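(* Let $B$ be a standard one-dimensional Brownian motion. For every continuous function $f\colon\mathbb{R}^+\to\mathbb{R}$, the set $\mathcal{Z}(B-f)=\{t>0:B(t)=f(t)\}$ has Hausdorff dimension greater than or equal to $1/2$ with positive probability.
   Context: $\mathbb{R}^+=[0,\infty)$; $B=(B(t))_{t\ge 0}$ starts at $0$. For a real function $g$ on $\mathbb{R}^+$, $\mathcal{Z}(g)$ denotes the set of zeros of $g$ in $(0,\infty)$. *)

(* Defs.v *)
From HB Require Import structures.
From mathcomp Require Import all_boot all_order all_algebra.
From mathcomp Require Import all_classical all_reals all_analysis.
From mathcomp Require Import measurable_realfun.

Set Implicit Arguments.
Unset Strict Implicit.
Unset Printing Implicit Defensive.

Import Order.TTheory GRing.Theory Num.Theory.
Import numFieldNormedType.Exports.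

Local Open Scope classical_set_scope.
Local Open Scope ring_scope.

Section Hausdorff.
Context {R : realType}.
Local Open Scope ereal_scope.

(* The element 0 makes the diameter of the empty set 0 instead of -oo. *)
Definition diameter (U : set R) : \bar R :=
  ereal_sup (0 |` [set `|x - y|%:E | x in U & y in U]).

(* The empty set is singled out because poweR gives 0 `^ 0 = 1: at s = 0 a
   nonempty set must weigh 1 and the empty set 0. *)
Definition diam_pow (s : R) (U : set R) : \bar R :=
  if U == set0 then 0 else diameter U `^ s.

Definition delta_cover (delta : R) (A : set R) (U : (set R)^nat) : Prop :=
  A `<=` \bigcup_i U i /\ forall i, diameter (U i) <= delta%:E.

Definition hausdorff_premeasure (s delta : R) (A : set R) : \bar R :=
  ereal_inf [set \sum_(0 <= i <oo) diam_pow s (U i) | U in delta_cover delta A].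

Definition hausdorff_measure (s : R) (A : set R) : \bar R :=
  ereal_sup [set hausdorff_premeasure s delta A |
              delta in [set delta : R | (0 < delta)%R]].

Definition hausdorff_dim (A : set R) : \bar R :=
  ereal_inf [set s%:E | s in
              [set s : R | (0 <= s)%R /\ hausdorff_measure s A = 0]].

End Hausdorff.

Section Brownian.
Context {d : measure_display} {T : measurableType d} {R : realType}.
Variable P : probability T R.

Definition mutually_independent (n : nat) (X : 'I_n -> {RV P >-> R}) : Prop :=
  forall (J : {set 'I_n}) (A : 'I_n -> set R), (forall i, measurable (A i)) ->
    P [set w | forall i, i \in J -> A i (X i w)] =
    (\prod_(i in J) P (X i @^-1` A i))%E.

Definition increment (B : R -> {RV P >-> R}) (s t : R) : {RV P >-> R} :=
  B t \- B s.

(* Only the times t >= 0 are constrained; the values of B at negative times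
   are irrelevant. The second parameter of normal_prob is the standard
   deviation. *)
Record brownian_motion (B : R -> {RV P >-> R}) : Prop := BrownianMotion {
  bm_start : {ae P, forall w, B 0 w = 0} ;
  bm_indep : forall (n : nat) (t : nat -> R),
    0 <= t 0%N -> (forall i, (i < n)%N -> t i < t i.+1) ->
    mutually_independent (fun i : 'I_n => increment B (t i) (t i.+1)) ;
  bm_gauss : forall s t : R, 0 <= s -> s < t ->
    forall A : set R, measurable A ->
      distribution P (increment B s t) A = normal_prob 0 (Num.sqrt (t - s)) A ;
  bm_cont : {ae P, forall w,
    {within `[0, +oo[%classic, continuous (fun t : R => B t w)}}
}.

(* E need not be known to be measurable: it is required to contain a
   measurable event of positive probability. When E itself is measurable (for
   P or for its completion) this amounts to P E > 0. *)
Definition with_positive_probability (E : set T) : Prop :=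
  exists F : set T, [/\ measurable F, F `<=` E & (0 < P F)%E].

End Brownian.

Definition zero_set {R : realType} (g : R -> R) : set R :=
  [set t | 0 < t /\ g t = 0].

(* Main.v *)
(* A discrete energy method on the time interval [[1, 2]]. For [N = m^2] let
   [S] be [1/m] times the number of grid points [t = 1 + k/N] at which
   [|B t - B 0 - f t| <= 1/m], and let [Phi] be the discrete energy of these
   grid points for the kernel [1 / psi], where [psi r = sqrt r * (4 - ln r)^2].
   Gaussian bounds give [E S >= c] and [E Phi <= C] uniformly in [m]: the
   logarithm makes [1 / (sqrt r * psi r)] integrable at [0], while [psi] is
   still dominated by [r^s] for every [s < 1/2]. A second moment argument yields
   events [S >= c', Phi <= M] of probability bounded below, hence with positive
   probability they occur for infinitely many [m]. On that event, if the zeros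
   had a cover with small [sum psi (diam)], by compactness finitely many of its
   sets would contain all the near zeros on a fine grid, and Cauchy-Schwarz over
   these sets would force [Phi] to be large. *)
Require Import Defs.
From HB Require Import structures.
From mathcomp Require Import all_boot all_order all_algebra.
From mathcomp Require Import all_classical all_reals all_analysis.
From mathcomp Require Import measurable_realfun.
From mathcomp Require Import ring lra zify.

Set Implicit Arguments.
Unset Strict Implicit.
Unset Printing Implicit Defensive.

Import Order.TTheory GRing.Theory Num.Theory.
Import numFieldNormedType.Exports.

Local Open Scope classical_set_scope.
Local Open Scope ring_scope.

(** * A gauge function of dimension one half *)

Section Gauge.
Context {R : realType}.
Implicit Types r s x : R.

(** The derivative vanishes at [r = 1]: 4 is the least constant for which this function increases on
    all of []0, 1]]. *)
Definition gauge r : R := Num.sqrt r * (4 - ln r) ^+ 2.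

Lemma gauge_expR (L : R) : gauge (expR (- L)) = expR (- L / 2) * (4 + L) ^+ 2.
Proof.
rewrite /gauge expRK opprK; congr (_ * _).
by rewrite [in LHS](splitr (- L)) expRD -expr2 sqrtr_sqr ger0_norm ?expR_ge0.
Qed.

Lemma expR_Nln r : 0 < r -> expR (- - ln r) = r.
Proof. by move=> r0; rewrite opprK lnK. Qed.

Lemma gauge_gt0 r : 0 < r <= 1 -> 0 < gauge r.
Proof.
move=> /andP[r0 r1]; rewrite mulr_gt0 ?sqrtr_gt0// exprn_gt0//.
by have := ln_le0 r1; lra.
Qed.

Lemma gauge1 : gauge 1 = 16.
Proof. by rewrite /gauge sqrtr1 ln1; ring. Qed.

(* With [L = - ln r] this is [(4 + L') / (4 + L) <= expR ((L' - L) / 4)]. *)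
Lemma gauge_le r x : 0 < r -> r <= x -> x <= 1 -> gauge r <= gauge x.
Proof.
move=> r0 rx x1; have x0 : 0 < x by lra.
rewrite -(expR_Nln r0) -(expR_Nln x0) !gauge_expR.
have L0 : 0 <= - ln x by have := ln_le0 x1; lra.
have LL' : - ln x <= - ln r by rewrite lerN2 ler_ln.
move: (- ln x) (- ln r) L0 LL' => L L' L0 LL'.
have h := expR_ge1Dx ((L' - L) / 4).
have -> : - L / 2 = - L' / 2 + ((L' - L) / 4) * 2 by field.
rewrite expRD -mulrA ler_pM2l ?expR_gt0// expRM_natr -exprMn ler_sqr ?nnegrE; last 2 first.
- lra.
- by rewrite mulr_ge0 ?expR_ge0//; lra.
nra.
Qed.

(** With [L = - ln r] and [a = (1/2 - s) / 2], the bound is the square of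
    [4 + L <= (4 + 1/a) * expR (a * L)], which follows from [expR u >= 1] and [expR u >= u] at
    [u = a * L]. *)
Lemma gauge_le_powR s : s < 2^-1 ->
  exists2 C : R, 0 < C & forall r, 0 < r -> r <= 1 -> gauge r <= C * r `^ s.
Proof.
move=> s2; pose a := (2^-1 - s) / 2; have a0 : 0 < a by rewrite /a; lra.
have ia : 0 < a^-1 by rewrite invr_gt0.
exists ((4 + a^-1) ^+ 2); first by rewrite exprn_gt0//; lra.
move=> r r0 r1; rewrite -(expR_Nln r0) gauge_expR.
have L0 : 0 <= - ln r by have := ln_le0 r1; lra.
move: (- ln r) L0 => L L0.
rewrite -expRM.
have -> : - L / 2 = - L * s - (a * L) * 2 by rewrite /a; field.
rewrite expRD mulrC [_ ^+ 2 * expR _]mulrC mulrCA ler_pM2l ?expR_gt0//.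
rewrite expRN expRM_natr ler_pdivrMr ?exprn_gt0 ?expR_gt0// -exprMn.
rewrite ler_sqr ?nnegrE; last 2 first.
- lra.
- by rewrite mulr_ge0 ?expR_ge0//; lra.
have h := expR_ge1Dx (a * L).
have h1 : 1 <= expR (a * L) by rewrite -[leLHS]expR0 ler_expR mulr_ge0// ltW.
have h2 : L <= a^-1 * expR (a * L).
  by rewrite mulrC ler_pdivlMr// mulrC; lra.
by rewrite mulrDl; lra.
Qed.

(* The summands are the increments of [2 / (4 - ln (j / N))] up to a factor. *)
Lemma sum_gauge_le (N : nat) :
  \sum_(1 <= j < N) j%:R^-1 / (4 - ln (j%:R / N%:R)) ^+ 2 <= 2^-1 :> R.
Proof.
have [->|N0] := posnP N; first by rewrite big_geq//; lra.
pose x (j : nat) : R := 4 - ln (j%:R / N%:R).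
have x4 j : (0 < j <= N)%N -> 4 <= x j.
  move=> /andP[j0 jN]; have : ln (j%:R / N%:R) <= 0 :> R.
    by rewrite ln_le0// ler_pdivrMr ?ltr0n// mul1r ler_nat.
  by rewrite /x; lra.
have key n : (n < N)%N -> \sum_(1 <= j < n.+2) j%:R^-1 / (x j) ^+ 2 <= 2 / x n.+1.
  elim: n => [_|n IH nN].
    rewrite big_nat1 invr1; have := x4 1%N; rewrite N0 => /(_ isT) x1.
    rewrite ler_pdivrMr ?exprn_gt0//; last lra.
    by rewrite expr2 mulrA divfK ?gt_eqF//; lra.
  rewrite big_nat_recr//=; have {}IH := IH (ltnW nN).
  apply: (le_trans (lerD IH (lexx _))).
  have xn : 4 <= x n.+1 by apply: x4; lia.
  have xn1 : 4 <= x n.+2 by apply: x4; lia.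
  have n1 : 0 < n.+1%:R :> R by rewrite ltr0n.
  have n2 : 0 < n.+2%:R :> R by rewrite ltr0n.
  have NR : 0 < N%:R :> R by rewrite ltr0n.
  (* This difference lies between [1 / n.+2] and 1. The lower bound compares the summand with the
     increment of [2 / x]; the upper bound and [x n.+1 >= 4] keep [x n.+2 / x n.+1] above 1/2, a
     loss absorbed by the factor 2. *)
  have d : x n.+1 - x n.+2 = ln (n.+2%:R / n.+1%:R).
    by rewrite /x !ln_div ?posrE//; ring.
  have d1 : x n.+1 - x n.+2 <= 1.
    rewrite d; have -> : n.+2%:R / n.+1%:R = 1 + n.+1%:R^-1 :> R.
      by rewrite -natr1 mulrDl divff ?mul1r// gt_eqF.
    apply: (le_trans (le_ln1Dx _)).
      by rewrite (lt_le_trans (ltrN10 R))// invr_ge0 ltW.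
    by rewrite invf_le1// ler1n.
  have d2 : n.+2%:R^-1 <= x n.+1 - x n.+2.
    rewrite d -[_ / _]invrK lnV ?posrE; last by rewrite invr_gt0 divr_gt0.
    rewrite invf_div lerNr.
    have -> : n.+1%:R / n.+2%:R = 1 + (- n.+2%:R^-1) :> R.
      by rewrite -[X in X / _](addrK 1) natr1 mulrBl divff ?gt_eqF// mul1r.
    apply: le_ln1Dx; rewrite ltrN2 invf_lt1//; rewrite ltr1n//.
  rewrite -lerBrDl.
  have -> : 2 / x n.+2 - 2 / x n.+1 = 2 * (x n.+1 - x n.+2) / (x n.+1 * x n.+2).
    by field; rewrite !gt_eqF//; lra.
  rewrite ler_pdivrMr ?exprn_gt0//; last lra.
  have -> : 2 * (x n.+1 - x n.+2) / (x n.+1 * x n.+2) * x n.+2 ^+ 2 =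
    2 * (x n.+1 - x n.+2) * (x n.+2 / x n.+1).
    by field; rewrite !gt_eqF//; lra.
  apply: (le_trans d2).
  have h1 : 2^-1 <= x n.+2 / x n.+1 by rewrite ler_pdivlMr; lra.
  have h2 : 0 < x n.+1 - x n.+2 by apply: lt_le_trans d2; rewrite invr_gt0.
  by rewrite -mulrA mulrCA ler_pMr// mulrC -ler_pdivrMr// mul1r.
(* At [j = N] the logarithm vanishes, so the telescoped bound is [2 / 4]. *)
have /key : (N.-1 < N)%N by lia.
rewrite prednK// big_nat_recr//= /x divff ?ln1 ?pnatr_eq0 -?lt0n//.
rewrite subr0 => h; apply: (le_trans _ (le_trans h _)); last lra.
by rewrite lerDl mulr_ge0// invr_ge0.
Qed.

End Gauge.

(** * Discrete energy of subsets of a grid *)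

Section Energy.
Context {R : realType}.

(** Truncated subtraction leaves at least one summand zero, so this is [|k - l|]. *)
Definition natdist (k l : nat) : nat := ((k - l) + (l - k))%N.

(* The maximum with 1 regularizes the diagonal. *)
Definition kernel (N k l : nat) : R :=
  (gauge ((maxn 1 (natdist k l))%:R / N%:R))^-1.

(** Each distance [j >= 1] occurs at most once on either side of [k]. *)
Lemma sum_natdist_le (h : nat -> R) (N k : nat) : (k < N)%N ->
    (forall j, 0 <= h j) ->
  \sum_(l < N | l != k :> nat) h (natdist k l) <= 2 * \sum_(1 <= j < N) h j.
Proof.
move=> kN h0.
have mono n : (n <= N)%N -> \sum_(1 <= j < n) h j <= \sum_(1 <= j < N) h j.
  move=> nN; have [n1|n1] := leqP 1 n; last first.
    by rewrite big_geq ?sumr_ge0//; lia.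
  by rewrite (big_cat_nat _ nN)//= lerDl sumr_ge0.
rewrite -(big_mkord (fun l => l != k) (fun l => h (natdist k l))).
rewrite (big_cat_nat (n := k))//=; last exact: ltnW.
rewrite [X in _ + X]big_ltn_cond// eqxx/= mulr_natl mulr2n lerD//.
- apply: le_trans (mono k.+1 kN).
  rewrite [leLHS]big_nat_rev/= add0n [leRHS]big_add1/=.
  rewrite [leLHS]big_nat_cond [leRHS]big_nat_cond le_eqVlt; apply/orP/or_introl/eqP.
  apply: eq_big => [j|j /andP[/andP[_ jk] _]]; first by lia.
  by congr h; rewrite /natdist; lia.
- apply: le_trans (mono (N - k)%N (leq_subr _ _)).
  rewrite -{1}[k.+1]add1n [leLHS]big_addn.
  rewrite [leLHS]big_nat_cond [leRHS]big_nat_cond le_eqVlt; apply/orP/or_introl/eqP.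
  apply: eq_big => [j|j _]; first by lia.
  by congr h; rewrite /natdist; lia.
Qed.

Lemma kernel_gt0 N k l : (k < N)%N -> (l < N)%N -> 0 < kernel N k l.
Proof.
move=> kN lN; rewrite /kernel /natdist invr_gt0 gauge_gt0//.
have N0 : 0 < N%:R :> R by rewrite ltr0n; lia.
by rewrite divr_gt0 ?ltr0n//= ?ler_pdivrMr// ?mul1r ?ler_nat; lia.
Qed.

Lemma kernel_le N k l (r : R) : (k < N)%N -> (l < N)%N -> r <= 1 ->
  N%:R^-1 <= r -> (natdist k l)%:R / N%:R <= r -> (gauge r)^-1 <= kernel N k l.
Proof.
move=> kN lN r1 Nr dr; have N0 : 0 < N%:R :> R by rewrite ltr0n; lia.
have m0 : 0 < (maxn 1 (natdist k l))%:R / N%:R :> R.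
  by rewrite divr_gt0// ltr0n leq_max.
have mr : (maxn 1 (natdist k l))%:R / N%:R <= r.
  by case: (leqP 1 (natdist k l)) => // _; rewrite mul1r.
rewrite /kernel lef_pV2 ?posrE ?gauge_gt0 ?m0 ?r1 ?(lt_le_trans m0) ?(le_trans mr)//.
exact: gauge_le.
Qed.

Lemma kernel_ge16 N k l : (k < N)%N -> (l < N)%N -> 16^-1 <= kernel N k l.
Proof.
move=> kN lN; have N0 : 0 < N%:R :> R by rewrite ltr0n; lia.
rewrite -gauge1 kernel_le//.
- by rewrite invf_le1// ler1n; lia.
- by rewrite ler_pdivrMr// mul1r ler_nat /natdist; lia.
Qed.

(** Let [c j] be the mass of the points assigned to piece [j]. Pairs inside that piece contribute at
    least [c j ^ 2 / gauge (r j)] to the energy, and [2 x c <= x ^ 2 g + c ^ 2 / g] by completing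
    the square. This is Cauchy-Schwarz in linearized form, with [x] free to be optimized later. *)
Lemma energy_ge_cover (m N n : nat) (E : pred nat) (i : nat -> nat)
    (r : nat -> R) (x : R) : (0 < m)%N -> N = (m ^ 2)%N ->
    (forall k, (k < N)%N -> E k -> (i k < n)%N) ->
    (forall j, (j < n)%N -> N%:R^-1 <= r j /\ r j <= 1) ->
    (forall k l, (k < N)%N -> (l < N)%N -> E k -> E l -> i k = i l ->
       (natdist k l)%:R / N%:R <= r (i k)) ->
  2 * x * (\sum_(k < N | E k) m%:R^-1) <=
    x ^+ 2 * (\sum_(j < n) gauge (r j)) +
    \sum_(k < N | E k) \sum_(l < N | E l) N%:R^-1 * kernel N k l.
Proof.
move=> m0 NE iE rj rd.
have mR : 0 < m%:R :> R by rewrite ltr0n.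
have N0 : 0 < N%:R :> R by rewrite ltr0n NE expn_gt0 m0.
have NR : N%:R^-1 = m%:R^-1 * m%:R^-1 :> R.
  by rewrite NE natrX expr2 invfM.
pose c (j : nat) : R := \sum_(k < N | E k && (i k == j)) m%:R^-1.
have -> : \sum_(k < N | E k) m%:R^-1 = \sum_(j < n) c j.
  rewrite /c (exchange_big_dep (fun k : 'I_N => E k))/=; last by move=> ? ? _ /andP[].
    apply: eq_bigr => k Ek.
    rewrite (big_pred1 (Ordinal (iE k (ltn_ord k) Ek)))// => j.
    by rewrite /= Ek eq_sym.
have h : \sum_(j < n) c j ^+ 2 / gauge (r j) <=
    \sum_(k < N | E k) \sum_(l < N | E l) N%:R^-1 * kernel N k l.
  have -> : \sum_(j < n) c j ^+ 2 / gauge (r j) =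
      \sum_(k < N | E k) \sum_(l < N | E l && (i l == i k)) N%:R^-1 / gauge (r (i k)).
    under eq_bigr => j _.
      rewrite expr2 {1}/c mulr_suml mulr_suml.
      over.
    rewrite (exchange_big_dep (fun k : 'I_N => E k))/=; last by move=> ? ? _ /andP[].
    apply: eq_bigr => k Ek.
    rewrite (big_pred1 (Ordinal (iE k (ltn_ord k) Ek)))/=; last first.
      by move=> j; rewrite /= Ek eq_sym.
    rewrite /c mulr_sumr mulr_suml; apply: eq_bigr => l _.
    by rewrite NR.
  apply: ler_sum => k Ek; rewrite big_mkcondr/=; apply: ler_sum => l El.
  case: ifPn => [/eqP ilk|_].
    rewrite ler_pM2l ?invr_gt0//; have [r1 r2] := rj _ (iE _ (ltn_ord k) Ek).
    by apply: kernel_le => //; exact: rd.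
  by apply: mulr_ge0; [rewrite invr_ge0 | exact/ltW/kernel_gt0].
apply: (le_trans _ (lerD (lexx _) h)).
rewrite !mulr_sumr -big_split/=; apply: ler_sum => j _.
have g0 : 0 < gauge (r j).
  have [r1 r2] := rj _ (ltn_ord j).
  by rewrite gauge_gt0// r2 andbT (lt_le_trans _ r1) ?invr_gt0.
move: (c j) (gauge (r j)) g0 => a g g0.
rewrite -subr_ge0.
have -> : x ^+ 2 * g + a ^+ 2 / g - 2 * x * a = (x * g - a) ^+ 2 / g.
  by field; rewrite gt_eqF.
by rewrite divr_ge0 ?sqr_ge0// ltW.
Qed.

(* Bounds the expected energy; the weights [p k l] are joint probabilities. *)
Lemma sum_kernel_le (m N : nat) (p : nat -> nat -> R) (C : R) : (0 < m)%N ->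
    N = (m ^ 2)%N -> 0 <= C -> (forall k, (k < N)%N -> p k k <= C / m%:R) ->
    (forall k l, (k < N)%N -> (l < N)%N -> k != l ->
       p k l <= C / N%:R * Num.sqrt (N%:R / (natdist k l)%:R)) ->
  \sum_(k < N) \sum_(l < N) N%:R^-1 * kernel N k l * p k l <= 2 * C.
Proof.
move=> m0 NE C0 pd pl.
have mR : 0 < m%:R :> R by rewrite ltr0n.
have N0 : 0 < N%:R :> R by rewrite ltr0n NE expn_gt0 m0.
have N1 : (0 < N)%N by rewrite -(ltr0n R).
have NR : N%:R = m%:R ^+ 2 :> R by rewrite NE natrX.
suff row (k : 'I_N) : \sum_(l < N) N%:R^-1 * kernel N k l * p k l <= N%:R^-1 * (2 * C).
  apply: (le_trans (ler_sum _ (fun k _ => row k))).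
  by rewrite sumr_const card_ord -[leLHS]mulr_natl mulrA divff ?mul1r// gt_eqF.
rewrite (bigD1 k)//=; under eq_bigr do rewrite -mulrA.
rewrite -mulr_sumr -mulrA -mulrDr ler_pM2l ?invr_gt0// mulr_natl mulr2n lerD//.
(* On the diagonal [sqrt (1 / N) = 1 / m] and the logarithmic factor is at least 1; the resulting
   [m] cancels against [C / m]. *)
- have kk : kernel N k k <= m%:R.
    rewrite /kernel /natdist subnn/= mul1r invf_ple ?posrE ?gauge_gt0//; last first.
      by rewrite invr_gt0 N0 invf_le1// ler1n.
    rewrite /gauge sqrtrV ?ler0n// NR sqrtr_sqr gtr0_norm//.
    rewrite ler_peMr ?invr_ge0 ?ler0n//.
    apply: exprn_ege1; have : ln (m%:R ^+ 2)^-1 <= 0 :> R; last lra.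
      by rewrite ln_le0// invf_le1 -?NR// ler1n.
  have := kernel_gt0 (ltn_ord k) (ltn_ord k); have := pd _ (ltn_ord k).
  move: (p k k) (kernel N k k) kk => q K Km qC K0.
  apply: (@le_trans _ _ (K * (C / m%:R))); first by rewrite ler_pM2l.
  rewrite mulrA ler_pdivrMr// mulrC ler_wpM2l//.
(* Off the diagonal the square root in the kernel and the one in the bound on [p] multiply to
   [N / j], which leaves the summand of [sum_gauge_le]. Its sum is at most 1/2 on each side of
   [k]. *)
- pose h (j : nat) : R := j%:R^-1 / (4 - ln (j%:R / N%:R)) ^+ 2.
  apply: (@le_trans _ _ (\sum_(l < N | l != k :> nat) C * h (natdist k l))).
    apply: ler_sum => l lk.
    apply: (le_trans (ler_wpM2l _ (pl _ _ (ltn_ord k) (ltn_ord l) _))).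
    + by rewrite ltW// kernel_gt0.
    + by rewrite eq_sym.
    rewrite /kernel /h.
    have d1 : (1 <= natdist k l)%N.
      by move: lk; rewrite /natdist -val_eqE/=; lia.
    have dN : (natdist k l <= N)%N.
      by have := ltn_ord k; have := ltn_ord l; rewrite /natdist; lia.
    have -> : maxn 1 (natdist k l) = natdist k l by exact/maxn_idPr.
    move: (natdist k l) d1 dN => j j1 jN.
    have j0 : 0 < j%:R :> R by rewrite ltr0n.
    have L : 0 < 4 - ln (j%:R / N%:R) :> R.
      have : ln (j%:R / N%:R) <= 0 :> R; last lra.
      by rewrite ln_le0// ler_pdivrMr// mul1r ler_nat.
    rewrite /gauge -[N%:R / j%:R]invf_div sqrtrV ?divr_ge0//.
    have := @sqr_sqrtr R (j%:R / N%:R).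
    have : 0 < Num.sqrt (j%:R / N%:R) :> R by rewrite sqrtr_gt0 divr_gt0.
    rewrite divr_ge0//; move: (Num.sqrt _) => q q0 /(_ isT) qE.
    rewrite [leLHS](_ : _ = C * (N%:R^-1 * (q ^+ 2)^-1 / (4 - ln (j%:R / N%:R)) ^+ 2)).
      rewrite qE invf_div [_^-1 * (_ / _)]mulrA mulVf ?mul1r// gt_eqF//.
    by field; rewrite !gt_eqF.
  rewrite -mulr_sumr.
  have := sum_natdist_le (ltn_ord k) (h := h); have := @sum_gauge_le R N.
  move=> h1 /(_ _) h2; rewrite -[leRHS]mulr1 ler_wpM2l//.
  apply: (le_trans (h2 _)).
    by move=> j; rewrite divr_ge0// sqr_ge0.
  by rewrite /h; lra.
Qed.

End Energy.

(** * Gaussian bounds and sums of indicators *)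

Section Probability.
Context {R : realType}.
Local Open Scope ereal_scope.

Lemma lebesgue_measure_cc (a b : R) : (a <= b)%R ->
  lebesgue_measure `[a, b]%classic = (b - a)%:E.
Proof.
move=> ab; rewrite lebesgue_measure_itv/= lte_fin -EFinB.
by move: ab; rewrite le_eqVlt => /predU1P[->|->]; rewrite ?ltxx ?subrr.
Qed.

(** The peak of the density is [1 / (sigma * sqrt (2 pi))], hence at most [1 / sigma]. *)
Lemma normal_prob_cc_le (sigma a b : R) : (0 < sigma)%R -> (a <= b)%R ->
  normal_prob 0 sigma `[a, b]%classic <= ((b - a) / sigma)%:E.
Proof.
move=> s0 ab; rewrite /normal_prob.
have s1 : sigma != 0%R by rewrite gt_eqF.
apply: (@le_trans _ _ (\int[lebesgue_measure]_(x in `[a, b]%classic) (sigma^-1)%:E)).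
  apply: ge0_le_integral => //=.
  - by move=> x _; rewrite lee_fin normal_pdf_ge0.
  - apply/measurable_EFinP; apply: measurable_funTS; exact: measurable_normal_pdf.
  - move=> x _; rewrite lee_fin; apply: (le_trans (normal_pdf_ub _ _ s1)).
    rewrite /normal_peak lef_pV2 ?posrE ?sqrtr_gt0//; last first.
      by rewrite mulrn_wgt0// mulr_gt0 ?pi_gt0// exprn_gt0.
    rewrite -[leLHS]ger0_norm ?(ltW s0)// -sqrtr_sqr ler_wsqrtr// -mulrnAr.
    rewrite ler_peMr ?sqr_ge0//; have := @pi_ge2 R; rewrite mulr2n; lra.
rewrite integral_cst//= lebesgue_measure_cc// -EFinM lee_fin mulrC lexx//.
Qed.

(** A lower bound on [[-M, M]] for all centred Gaussian densities of variance between 1 and 2: the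
    peak is smallest at variance 2, the exponential at variance 1. *)
Definition normal_lb (M : R) : R := normal_peak (Num.sqrt 2) * expR (- M ^+ 2 / 2).

Lemma normal_lb_gt0 M : (0 < normal_lb M)%R.
Proof.
by rewrite mulr_gt0 ?expR_gt0// normal_peak_gt0// gt_eqF// sqrtr_gt0.
Qed.

Lemma normal_prob_cc_ge (v a b M : R) : (1 <= v)%R -> (v <= 2)%R ->
    (- M <= a)%R -> (a <= b)%R -> (b <= M)%R ->
  ((b - a) * normal_lb M)%:E <= normal_prob 0 (Num.sqrt v) `[a, b]%classic.
Proof.
move=> v1 v2 Ma ab bM.
have v0 : (0 < v)%R by lra.
have s0 : (0 < Num.sqrt v)%R by rewrite sqrtr_gt0.
rewrite /normal_prob.
apply: (@le_trans _ _ (\int[lebesgue_measure]_(x in `[a, b]%classic) (normal_lb M)%:E)).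
  by rewrite integral_cst//= lebesgue_measure_cc// -EFinM lee_fin mulrC.
apply: ge0_le_integral => //=.
- by move=> x _; rewrite lee_fin ltW// normal_lb_gt0.
- by apply/measurable_EFinP; apply: measurable_funTS; exact: measurable_normal_pdf.
move=> x; rewrite in_itv/= => /andP[ax xb]; rewrite lee_fin normal_pdfE ?gt_eqF//.
apply: ler_pM; rewrite ?normal_peak_ge0 ?expR_ge0//.
  rewrite /normal_peak !sqr_sqrtr// ?(ltW v0)// lef_pV2 ?posrE ?sqrtr_gt0//.
  - by rewrite ler_wsqrtr// lerMn2r/= ler_wpM2r// pi_ge0.
  - by rewrite mulrn_wgt0// mulr_gt0 ?pi_gt0.
  - by rewrite mulrn_wgt0// mulr_gt0 ?pi_gt0.
rewrite /normal_fun ler_expR subr0 sqr_sqrtr ?(ltW v0)// !mulNr lerN2.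
rewrite ler_pdivrMr ?mulrn_wgt0// mulr2n.
have xM : (x ^+ 2 <= M ^+ 2)%R by nra.
have -> : (M ^+ 2 / 2 * (v + v) = M ^+ 2 * v)%R by field.
by rewrite (le_trans xM)// ler_peMr ?sqr_ge0.
Qed.

Context {d : measure_display} {T : measurableType d} (P : probability T R).

Lemma fine_probability_ge0 (A : set T) : (0 <= fine (P A))%R.
Proof. exact/fine_ge0/measure_ge0. Qed.

Lemma integral_sum_indic (I : Type) (r : seq I) (a : I -> R) (A : I -> set T) :
    (forall i, 0 <= a i)%R -> (forall i, measurable (A i)) ->
  \int[P]_w (\sum_(i <- r) a i * \1_(A i) w)%:E =
  (\sum_(i <- r) a i * fine (P (A i)))%:E.
Proof.
move=> a0 mA; under eq_integral do rewrite -sumEFin.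
rewrite -sumEFin ge0_integral_sum//; last 2 first.
- move=> i; apply/measurable_EFinP/measurable_funM => //; exact: measurable_indic.
- by move=> i w _; rewrite lee_fin mulr_ge0.
apply: eq_bigr => i _; under eq_integral do rewrite EFinM.
rewrite ge0_integralZl//; last 2 first.
- by apply/measurable_EFinP; exact: measurable_indic.
- by rewrite lee_fin.
by rewrite integral_indic// setIT EFinM fineK// fin_num_measure.
Qed.

(** Taking expectations on both sides; a moment estimate is thereby reduced to a pointwise
    inequality between combinations of indicators. *)
Lemma sum_indic_le (I J : Type) (r : seq I) (s : seq J) (a : I -> R)
    (A : I -> set T) (b : J -> R) (B : J -> set T) :
    (forall i, 0 <= a i)%R -> (forall i, measurable (A i)) ->
    (forall j, 0 <= b j)%R -> (forall j, measurable (B j)) ->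
    (forall w, \sum_(i <- r) a i * \1_(A i) w <= \sum_(j <- s) b j * \1_(B j) w)%R ->
  (\sum_(i <- r) a i * fine (P (A i)) <= \sum_(j <- s) b j * fine (P (B j)))%R.
Proof.
move=> a0 mA b0 mB le; rewrite -lee_fin -!integral_sum_indic//.
have mf K (t : seq K) (e : K -> R) (F : K -> set T) : (forall i, measurable (F i)) ->
    measurable_fun setT (fun w => (\sum_(i <- t) e i * \1_(F i) w)%:E).
  move=> mF; apply/measurable_EFinP; apply: measurable_sum => i.
  by apply: measurable_funM => //; exact: measurable_indic.
apply: ge0_le_integral => //; try exact: mf.
- by move=> w _; rewrite lee_fin sumr_ge0// => i _; rewrite mulr_ge0.
- by move=> w _; rewrite lee_fin.
Qed.

End Probability.

(** * Second moment argument for the occupation and the energy *)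

Section EnergyEvent.
Context {R : realType} {d : measure_display} {T : measurableType d}.
Variable P : probability T R.
Variables (m N : nat) (E : nat -> set T).
Hypothesis NE : N = (m ^ 2)%N.
Hypothesis mE : forall k, measurable (E k).

Definition occupation (w : T) : R := \sum_(k < N) m%:R^-1 * \1_(E k) w.

Definition energy (w : T) : R :=
  \sum_(k < N) \sum_(l < N) N%:R^-1 * kernel N k l * (\1_(E k) w * \1_(E l) w).

Definition energy_event (c M : R) : set T :=
  [set w | c <= occupation w /\ energy w <= M].

Lemma measurable_energy_event c M : measurable (energy_event c M).
Proof.
have mI k : measurable_fun setT (\1_(E k) : T -> R) by exact: measurable_indic.
have mo : measurable_fun setT occupation.
  by apply: measurable_sum => k; apply: measurable_funM.
have me : measurable_fun setT energy.
  apply: measurable_sum => k; apply: measurable_sum => l.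
  by apply: measurable_funM => //; apply: measurable_funM.
rewrite (_ : energy_event c M =
  occupation @^-1` `[c, +oo[%classic `&` energy @^-1` `]-oo, M]%classic).
  by apply: measurableI; rewrite -[X in measurable X]setTI; [apply: mo|apply: me].
by apply/seteqP; split=> w /=; rewrite !in_itv/= andbT.
Qed.

Lemma energy_ge0 w : 0 <= energy w.
Proof.
apply: sumr_ge0 => k _; apply: sumr_ge0 => l _.
by rewrite !mulr_ge0//; exact/ltW/kernel_gt0.
Qed.

(** The square is a double sum with weights [m^-2 = N^-1], and every kernel value is at least
    1/16. *)
Lemma occupation_sqr_le w : occupation w ^+ 2 <= 16 * energy w.
Proof.
rewrite /energy /occupation expr2 [leRHS]mulr_sumr mulr_suml; apply: ler_sum => k _.
rewrite !mulr_sumr; apply: ler_sum => l _.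
have -> : m%:R^-1 * \1_(E k) w * (m%:R^-1 * \1_(E l) w) =
    N%:R^-1 * (\1_(E k) w * \1_(E l) w) :> R.
  by rewrite (_ : N%:R = m%:R ^+ 2 :> R) ?NE ?natrX// -exprVn mulrACA -expr2.
rewrite -[N%:R^-1 * kernel _ _ _ * _]mulrA [leRHS]mulrCA; apply: ler_wpM2l; rewrite ?invr_ge0//.
rewrite mulrA ler_peMl ?mulr_ge0//.
by have := @kernel_ge16 R _ _ _ (ltn_ord k) (ltn_ord l); lra.
Qed.

(* A second moment argument in which the energy also controls the square of
   the occupation. *)
Lemma energy_event_ge (c C a M : R) : 0 < a -> 0 < M -> 0 <= c ->
    (a / M + 16 / a) * C <= c / 4 ->
    c <= \sum_(k < N) m%:R^-1 * fine (P (E k)) ->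
    \sum_(k < N) \sum_(l < N)
      N%:R^-1 * kernel N k l * fine (P (E k `&` E l)) <= C ->
  c / (4 * a) <= fine (P (energy_event (c / 2) M)).
Proof.
move=> a0 M0 c0 qC hc hC.
set G := energy_event _ _.
have mG : measurable G by exact: measurable_energy_event.
(* The pointwise bound will be [occupation <= c / 2 + a * \1_G + q * energy]. Outside [G], an
   occupation between [c / 2] and [a] forces [energy > M], paid for by [a / M]; an occupation above
   [a] is at most its square over [a], paid for by [16 / a]. *)
pose q := a / M + 16 / a.
have q0 : 0 < q by rewrite addr_gt0// divr_gt0.
(* [None] indexes the constant, [Some None] the event [G], and the pairs index the terms of the
   energy. *)
pose J := option (option ('I_N * 'I_N)%type).
pose b (j : J) : R := if j is Some o then
  if o is Some (k, l) then q * (N%:R^-1 * kernel N k l) else a else c / 2.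
pose F (j : J) : set T := if j is Some o then
  if o is Some (k, l) then E k `&` E l else G else setT.
pose s : seq J := None :: Some None :: [seq Some (Some p) | p <- index_enum ('I_N * 'I_N)%type].
have sE (g : J -> R) : \sum_(j <- s) g j = g None + (g (Some None) +
    \sum_(k < N) \sum_(l < N) g (Some (Some (k, l)))).
  rewrite !big_cons big_map pair_bigA/=; congr (_ + (_ + _)).
  by apply: eq_bigr => -[].
have pointwise w : \sum_(k < N) m%:R^-1 * \1_(E k) w <= \sum_(j <- s) b j * \1_(F j) w.
  rewrite sE /= indicT mulr1.
  have -> : \sum_(k < N) \sum_(l < N) q * (N%:R^-1 * kernel N k l) *
      \1_(E k `&` E l) w = q * energy w.
    rewrite /energy mulr_sumr; apply: eq_bigr => k _.
    rewrite mulr_sumr; apply: eq_bigr => l _.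
    by rewrite indicI -mulrA.
  rewrite -/(occupation w).
  have S2 := occupation_sqr_le w; have F0 := energy_ge0 w.
  have qF : a / M * energy w + 16 / a * energy w = q * energy w by rewrite /q [RHS]mulrDl.
  have aM0 : 0 <= a / M * energy w by apply: mulr_ge0 => //; exact/ltW/divr_gt0.
  have a160 : 0 <= 16 / a * energy w by apply: mulr_ge0 => //; exact/ltW/divr_gt0.
  have I0 : 0 <= a * \1_G w by apply: mulr_ge0 => //; exact: ltW.
  have [Sc|Sc] := ltP (occupation w) (c / 2); first lra.
  have [Sa|Sa] := leP (occupation w) a.
    have [FM|FM] := leP (energy w) M.
      rewrite indicE mem_set//= in I0 *; rewrite mulr1 in I0 *; lra.
    have : a <= a / M * energy w by rewrite mulrAC ler_pdivlMr// ler_pM2l// ltW.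
    lra.
  have : occupation w <= 16 / a * energy w.
    rewrite mulrAC ler_pdivlMr//; apply: le_trans S2; rewrite expr2.
    by rewrite ler_wpM2l// ?ltW//; apply: lt_trans Sa.
  lra.
have := @sum_indic_le R d T P _ J (index_enum 'I_N) s (fun=> m%:R^-1) (fun k => E k) b F.
move=> /(_ _ _ _ _ pointwise) h.
have {h} : \sum_(k < N) m%:R^-1 * fine (P (E k)) <= \sum_(j <- s) b j * fine (P (F j)).
  apply: h => //.
  - case=> [[[k l]|]|]/=; [|exact: ltW|by rewrite divr_ge0].
    by rewrite !mulr_ge0//; [exact: ltW|exact/ltW/kernel_gt0].
  - by case=> [[[k l]|]|]//=; apply: measurableI.
rewrite sE /= probability_setT mulr1.
have -> : \sum_(k < N) \sum_(l < N) q * (N%:R^-1 * kernel N k l) * fine (P (E k `&` E l))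
    = q * \sum_(k < N) \sum_(l < N) N%:R^-1 * kernel N k l * fine (P (E k `&` E l)).
  rewrite mulr_sumr; apply: eq_bigr => k _.
  by rewrite mulr_sumr; apply: eq_bigr => l _; rewrite [RHS]mulrA.
set Y := (X in q * X) => h; rewrite -/Y in hC.
have {}qC : q * Y <= c / 4.
  by apply: le_trans qC; rewrite ler_pM2l.
have : c / 4 <= a * fine (P G) by lra.
rewrite -ler_pdivrMl// => h2; apply: le_trans h2.
by rewrite invfM mulrA [leLHS]mulrC.
Qed.

End EnergyEvent.

(** * Brownian increments *)

Section Brownian.
Context {R : realType} {d : measure_display} {T : measurableType d}.
Variable P : probability T R.
Variable B : R -> {RV P >-> R}.
Hypothesis hB : brownian_motion B.

Definition increment_near (s t y e : R) : set T :=
  increment B s t @^-1` `[y - e, y + e]%classic.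

Lemma increment_nearE (s t y e : R) w :
  increment_near s t y e w = (`|B t w - B s w - y| <= e) :> Prop.
Proof.
rewrite /increment_near /= in_itv/=; apply/propext.
by rewrite ler_norml !lerBrDr !lerBlDr [- e + y]addrC [y + e]addrC.
Qed.

Lemma measurable_increment_near s t y e : measurable (increment_near s t y e).
Proof. by rewrite /increment_near -[X in measurable X]setTI; exact: measurable_funP. Qed.

Lemma prob_increment_near_le (s t y e : R) : 0 <= s -> s < t -> 0 <= e ->
  fine (P (increment_near s t y e)) <= 2 * e / Num.sqrt (t - s).
Proof.
move=> s0 st e0; rewrite -lee_fin fineK ?fin_num_measure//; last first.
  exact: measurable_increment_near.
have := bm_gauss hB s0 st (A := `[y - e, y + e]%classic) (measurable_itv _).
rewrite /distribution/= /pushforward => ->.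
apply: (le_trans (normal_prob_cc_le _ _)); rewrite ?sqrtr_gt0 ?subr_gt0//; first lra.
by rewrite lee_fin; have -> : y + e - (y - e) = 2 * e by ring.
Qed.

Lemma prob_increment_near_ge (t y e M : R) : 1 <= t -> t <= 2 -> 0 <= e -> `|y| + e <= M ->
  2 * e * normal_lb M <= fine (P (increment_near 0 t y e)).
Proof.
move=> t1 t2 e0 yM; rewrite -lee_fin fineK ?fin_num_measure//; last first.
  exact: measurable_increment_near.
have t0 : 0 < t by lra.
have := bm_gauss hB (lexx 0) t0 (A := `[y - e, y + e]%classic) (measurable_itv _).
rewrite /distribution/= /pushforward => ->; rewrite subr0.
have := ler_norm y; have := ler_norm (- y); rewrite normrN => h1 h2.
apply: (le_trans _ (@normal_prob_cc_ge _ _ _ _ M _ _ _ _ _)); [|lra|lra|lra|lra|lra].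
by have -> : y + e - (y - e) = 2 * e by ring.
Qed.

Lemma prob_increment_near2 (s t y y' e e' : R) : 0 < s -> s < t ->
  P (increment_near 0 s y e `&` increment_near s t y' e') =
  (P (increment_near 0 s y e) * P (increment_near s t y' e'))%E.
Proof.
move=> s0 st.
(* The times are [0 < s < t]; [u] may stay at [t] from index 2 on because strict increase is asked
   only for [i < 2]. *)
pose u (i : nat) : R := if i == 0%N then 0 else if i == 1%N then s else t.
have := bm_indep hB (n := 2) (t := u) (lexx _) _.
move=> /(_ _) /(_ [set: 'I_2]%SET (fun i : 'I_2 =>
  if i == ord0 then `[y - e, y + e]%classic else `[y' - e', y' + e']%classic)).
move=> h; rewrite -[RHS]mule1 -muleA.
have {h} := h.
rewrite big_set/= big_mkcond/= !big_ord_recl big_ord0/= => hh.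
apply: (etrans _ (hh _ _)).
- congr (P _); apply/seteqP; split => w /=.
  + move=> [h1 h2] i _; case: i => -[|[|//]] ? //.
  + by move=> h; split;
      [exact: (h ord0 (finset.in_setT _))|exact: (h (lift ord0 ord0) (finset.in_setT _))].
- by case=> [|[|]].
- by move=> i; case: ifP.
Qed.

End Brownian.

(** * Near zeros of [B - f] on a grid in [[1, 2]] *)

Section NearZeros.
Context {R : realType} {d : measure_display} {T : measurableType d}.
Variable P : probability T R.

(** Continuity from above along the decreasing tail unions, each of which has probability at least
    [e]. *)
Lemma prob_lim_sup_set_ge (F : nat -> set T) (e : R) :
    (forall n, measurable (F n)) -> (forall n, e <= fine (P (F n))) ->
  (e%:E <= P (lim_sup_set F))%E.
Proof.
move=> mF eF.
have mU n : measurable (\bigcup_(k in [set k | (n <= k)%N]) F k).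
  exact: bigcup_measurable.
have cvgF : (P (\bigcup_(k in [set k | (n <= k)%N]) F k) @[n --> \oo] -->
    P (lim_sup_set F))%classic.
  by apply: lim_sup_set_cvg => //; rewrite -ge0_fin_numE// fin_num_measure.
rewrite -(cvg_lim _ cvgF)//; apply: lime_ge; first by apply/cvg_ex; eexists; exact: cvgF.
apply: nearW => n; apply: (@le_trans _ _ (P (F n))).
  by rewrite -(@fineK _ (P (F n))) ?lee_fin// fin_num_measure.
by apply: le_measure; rewrite ?inE// => w Fw; exists n => /=.
Qed.

Variable B : R -> {RV P >-> R}.
Hypothesis hB : brownian_motion B.
Variables (f : R -> R) (M : R).
Hypothesis fM : forall t : R, 1 <= t <= 2 -> `|f t| + 1 <= M.

Definition grid (N k : nat) : R := 1 + k%:R / N%:R.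

(** The increment from time 0 replaces [B t], since the law is given for increments and [B 0 = 0]
    holds only almost surely. The tolerance [1 / m] is the Brownian scale of the mesh
    [1 / m ^ 2]. *)
Definition near_zero (m k : nat) : set T :=
  increment_near B 0 (grid (m ^ 2) k) (f (grid (m ^ 2) k)) m%:R^-1.

Lemma gridP N k : (k < N)%N -> 1 <= grid N k <= 2.
Proof.
move=> kN; rewrite /grid lerDl divr_ge0//= -[2]/(1 + 1) lerD2l.
by rewrite ler_pdivrMr ?mul1r ?ler_nat ?ltr0n; lia.
Qed.

Lemma prob_near_zero_ge m k : (0 < m)%N -> (k < m ^ 2)%N ->
  2 / m%:R * normal_lb M <= fine (P (near_zero m k)).
Proof.
move=> m0 kN; have /andP[t1 t2] := gridP kN.
have m1 : m%:R^-1 <= 1 :> R by rewrite invf_le1 ?ltr0n// ler1n.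
apply: prob_increment_near_ge => //.
by apply: le_trans (fM (gridP kN)); rewrite lerD2l.
Qed.

Lemma prob_near_zero_le m k : (0 < m)%N -> (k < m ^ 2)%N ->
  fine (P (near_zero m k)) <= 2 / m%:R.
Proof.
move=> m0 kN; have /andP[t1 t2] := gridP kN.
have s1 : 1 <= Num.sqrt (grid (m ^ 2) k) by rewrite -[leLHS]sqrtr1 ler_wsqrtr.
apply: (le_trans (prob_increment_near_le hB _ _ _ _)) => //; first lra.
rewrite subr0 ler_pdivrMr; last lra.
by rewrite ler_peMr// divr_ge0.
Qed.

(** Two near zeros at times [u < v] force the increment over [[u, v]] to be within [2 / m] of
    [f v - f u]. Independence then bounds the probability by [2 / m] times
    [(4 / m) / sqrt (v - u)]. *)
Lemma prob_near_zero2_le m k l : (0 < m)%N -> (k < m ^ 2)%N -> (l < m ^ 2)%N ->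
    (k < l)%N ->
  fine (P (near_zero m k `&` near_zero m l)) <=
  8 / (m ^ 2)%:R * Num.sqrt ((m ^ 2)%:R / (natdist k l)%:R).
Proof.
move=> m0 kN lN kl; have /andP[t1 t2] := gridP kN.
have N0 : 0 < (m ^ 2)%:R :> R by rewrite ltr0n expn_gt0 m0.
have mR : 0 < m%:R :> R by rewrite ltr0n.
have dE : grid (m ^ 2) l - grid (m ^ 2) k = (natdist k l)%:R / (m ^ 2)%:R.
  rewrite /grid /natdist (_ : (k - l + (l - k) = l - k)%N); last lia.
  by rewrite natrB 1?ltnW//; ring.
have j0 : 0 < (natdist k l)%:R :> R by rewrite ltr0n /natdist; lia.
have tkl : grid (m ^ 2) k < grid (m ^ 2) l by rewrite -subr_gt0 dE divr_gt0.
set u := grid (m ^ 2) k in t1 t2 dE tkl *; set v := grid (m ^ 2) l in dE tkl *.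
pose A := increment_near B 0 u (f u) m%:R^-1.
pose A' := increment_near B u v (f v - f u) (2 / m%:R).
have mA : measurable A by exact: measurable_increment_near.
have mA' : measurable A' by exact: measurable_increment_near.
have sub : near_zero m k `&` near_zero m l `<=` A `&` A'.
  move=> w []; rewrite /near_zero -/u -/v => hu hv; split=> //.
  move: hu hv; rewrite /A' !increment_nearE => hu hv.
  have -> : B v w - B u w - (f v - f u) = (B v w - B 0 w - f v) - (B u w - B 0 w - f u) by ring.
  apply: (le_trans (ler_normB _ _)); rewrite mulr_natl mulr2n; exact: lerD.
have mn i : measurable (near_zero m i) by exact: measurable_increment_near.
apply: (@le_trans _ _ (fine (P A) * fine (P A'))).
  rewrite -fineM ?fin_num_measure// -prob_increment_near2//; last lra.
  apply: fine_le; rewrite ?fin_num_measure//; try exact: measurableI.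
  by apply: le_measure; rewrite ?inE//; apply: measurableI.
have s0 : 0 < v - u by rewrite subr_gt0.
have pA : fine (P A) <= 2 / m%:R := prob_near_zero_le m0 kN.
have pA' : fine (P A') <= 2 * (2 / m%:R) / Num.sqrt (v - u).
  by apply: prob_increment_near_le => //; lra.
apply: (le_trans (ler_pM (fine_probability_ge0 _ _) (fine_probability_ge0 _ _) pA pA')).
rewrite dE -[(m ^ 2)%:R / (natdist k l)%:R]invf_div sqrtrV ?divr_ge0//.
have : 0 < Num.sqrt ((natdist k l)%:R / (m ^ 2)%:R) :> R by rewrite -dE sqrtr_gt0.
move: (Num.sqrt _) => q q0; rewrite natrX le_eqVlt; apply/orP; left; apply/eqP.
by field; rewrite !gt_eqF.
Qed.

Lemma near_zero_energy_event : exists c M' e : R, [/\ 0 < c, 0 < e &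
  forall m, (0 < m)%N ->
    e <= fine (P (energy_event m (m ^ 2) (near_zero m) c M'))].
Proof.
(* [c] bounds the expected occupation from below: [m ^ 2] terms, each at least
   [(1 / m) * (2 / m) * normal_lb M]. [C = 2 * 8] comes from [sum_kernel_le], and [a], [M'] make
   [a / M' * C] and [16 / a * C] both equal to [c / 8]. *)
pose c := 2 * normal_lb M; pose C : R := 16.
have c0 : 0 < c by rewrite mulr_gt0// normal_lb_gt0.
have C0 : 0 < C by [].
pose a := 8 * (16 * C) / c; pose M' := 8 * (a * C) / c.
have a0 : 0 < a by rewrite divr_gt0// mulr_gt0// mulr_gt0.
have M0 : 0 < M' by rewrite divr_gt0// mulr_gt0// mulr_gt0.
exists (c / 2), M', (c / (4 * a)); split.
- by rewrite divr_gt0.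
- by rewrite divr_gt0// mulr_gt0.
move=> m m0.
have mR : 0 < m%:R :> R by rewrite ltr0n.
apply: (@energy_event_ge _ _ _ P m (m ^ 2) _ erefl _ c C a M') => //.
- by move=> k; exact: measurable_increment_near.
- exact: ltW.
- rewrite le_eqVlt; apply/orP; left; apply/eqP.
  by rewrite /M' /a; field; rewrite !gt_eqF.
- apply: (@le_trans _ _ (\sum_(k < m ^ 2) m%:R^-1 * (2 / m%:R * normal_lb M))).
    rewrite sumr_const card_ord -[leRHS]mulr_natl natrX le_eqVlt; apply/orP; left; apply/eqP.
    by rewrite /c; field; rewrite gt_eqF.
  by apply: ler_sum => k _; rewrite ler_pM2l ?invr_gt0// prob_near_zero_ge.
- have -> : C = 2 * 8 by rewrite /C; ring.
  pose p k l := fine (P (near_zero m k `&` near_zero m l)).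
  apply: (@sum_kernel_le R m (m ^ 2) p 8 m0 erefl) => //.
  + move=> k kN; rewrite /p setIid; apply: (le_trans (prob_near_zero_le m0 kN)).
    by rewrite ler_pM2r ?invr_gt0// ler_nat.
  + move=> k l kN lN; rewrite neq_ltn => /orP[kl|lk]; first exact: prob_near_zero2_le.
    rewrite /p setIC (_ : natdist k l = natdist l k); last by rewrite /natdist addnC.
    exact: prob_near_zero2_le.
Qed.

End NearZeros.

(** * A criterion for Hausdorff dimension at least one half *)

Section Dimension.
Context {R : realType}.

Lemma diameter_ge0 (U : set R) : (0 <= diameter U)%E.
Proof. by apply: ereal_sup_ubound; left. Qed.

Lemma norm_le_diameter (U : set R) (D : R) x y : (diameter U <= D%:E)%E ->
  U x -> U y -> `|x - y| <= fine (diameter U).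
Proof.
move=> UD Ux Uy; rewrite -lee_fin fineK; last first.
  by rewrite ge0_fin_numE ?diameter_ge0// (le_lt_trans UD)// ltry.
by apply: ereal_sup_ubound; right; exists x => //; exists y.
Qed.

Lemma diameter_set0 : diameter (set0 : set R) = 0%E.
Proof.
rewrite /diameter (_ : _ `|` _ = [set 0%E]) ?ereal_sup1//.
by apply/seteqP; split=> x /=; [case=> // -[? []] | left].
Qed.

(** A strictly larger exponent is positive, so the power vanishes at diameter 0 and the conventions
    for exponent 0 do no harm. *)
Lemma powR_fine_diameter_le (U : set R) (s s' : R) : 0 <= s -> s < s' ->
  (diameter U <= 1)%E -> ((fine (diameter U) `^ s')%:E <= diam_pow s U)%E.
Proof.
move=> s0 ss' U1; have s'0 : s' != 0 by rewrite gt_eqF// (le_lt_trans s0).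
rewrite /diam_pow; case: eqP => [->|_]; first by rewrite diameter_set0 powR0.
have fU : diameter U \is a fin_num.
  by rewrite ge0_fin_numE ?diameter_ge0// (le_lt_trans U1)// ltry.
move: U1 (diameter_ge0 U); rewrite -(fineK fU) poweR_EFin !lee_fin/= => U1.
rewrite le_eqVlt => /predU1P[<-|D0]; first by rewrite powR0// powR_ge0.
by apply: ger_powR; rewrite ?D0// ltW.
Qed.

Lemma powRD_le (s x y : R) : 0 <= s -> 0 <= x -> 0 <= y ->
  (x + y) `^ s <= 2 `^ s * (x `^ s + y `^ s).
Proof.
move=> s0 x0 y0; wlog xy : x y x0 y0 / x <= y => [hw|].
  have [xy|yx] := leP x y; first exact: hw.
  by rewrite addrC [x `^ s + _]addrC; apply: hw => //; exact: ltW.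
apply: (@le_trans _ _ ((2 * y) `^ s)).
  by apply: ge0_ler_powR; rewrite ?nnegrE//; lra.
rewrite powRM// ler_wpM2l ?powR_ge0// lerDr powR_ge0//.
Qed.

Lemma sum_half_le (e : R) n : 0 <= e -> \sum_(i < n) e / 2 ^+ i.+1 <= e.
Proof.
move=> e0; suff -> : \sum_(i < n) e / 2 ^+ i.+1 = e - e / 2 ^+ n.
  by rewrite gerBl divr_ge0// exprn_ge0.
elim: n => [|n IH]; first by rewrite big_ord0 expr0 divr1 subrr.
rewrite big_ord_recr/= IH exprS.
have : 2 ^+ n != 0 :> R by rewrite expf_neq0.
by move=> ?; field.
Qed.

(** Each set of a cheap cover is enlarged to an open interval about one of its points, with radius
    its diameter plus a small [eta i]. An exponent [s'] between [s] and 1/2 dominates the gauge and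
    makes the cost of the enlargement summable. *)
Lemma hausdorff_null_cover (A : set R) (s e : R) : 0 <= s -> s < 2^-1 ->
    hausdorff_measure s A = 0%E -> 0 < e ->
  exists x r : nat -> R, [/\ forall i, 0 < r i <= 1,
    A `<=` \bigcup_i [set y | `|y - x i| < r i / 2] &
    forall n, \sum_(i < n) gauge (r i) <= e].
Proof.
move=> s0 s2 HA e0; pose s' := (s + 2^-1) / 2.
have ss' : s < s' by rewrite /s'; lra.
have s'2 : s' < 2^-1 by rewrite /s'; lra.
have s'0 : 0 < s' by lra.
have [C C0 gC] := gauge_le_powR s'2.
(* One power of 2 comes from doubling the radius, the other from [powRD_le]. The diameters and the
   [eta i] will each contribute at most [K * e1 = e / 2]. *)
pose K := C * (2 `^ s' * 2 `^ s').
have K0 : 0 < K by rewrite mulr_gt0// mulr_gt0// powR_gt0.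
pose e1 := e / (2 * K).
have e10 : 0 < e1 by rewrite divr_gt0// mulr_gt0.
(* Diameters and [eta i] at most 1/4 give [2 * (D i + eta i) <= 1], as required for the gauge. *)
have : (hausdorff_premeasure s 4^-1 A < e1%:E)%E.
  apply: (@le_lt_trans _ _ 0%E); last by rewrite lte_fin.
  rewrite -HA; apply: ereal_sup_ubound; exists 4^-1 => //=.
move=> /ereal_inf_lt[_ [U [AU Ud] <-]] sumU.
pose D i := fine (diameter (U i)).
have D0 i : 0 <= D i by rewrite fine_ge0// diameter_ge0.
have D4 i : D i <= 4^-1.
  rewrite -lee_fin fineK ?Ud// ge0_fin_numE ?diameter_ge0//.
  by rewrite (le_lt_trans (Ud i))// ltry.
pose eta i : R := Num.min 4^-1 ((e1 / 2 ^+ i.+1) `^ s'^-1).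
have e1i i : 0 < e1 / 2 ^+ i.+1 by rewrite divr_gt0// exprn_gt0.
have eta0 i : 0 < eta i by rewrite lt_min invr_gt0 ltr0n powR_gt0.
have eta4 i : eta i <= 4^-1 by rewrite ge_min lexx.
have etas i : eta i `^ s' <= e1 / 2 ^+ i.+1.
  apply: (@le_trans _ _ (((e1 / 2 ^+ i.+1) `^ s'^-1) `^ s')).
    apply: ge0_ler_powR; rewrite ?nnegrE ?powR_ge0//; first exact: ltW.
    - exact: ltW.
    - by rewrite ge_min lexx orbT.
  by rewrite -powRrM mulVf ?gt_eqF// powRr1// ltW.
exists (fun i => xget 0 (U i)), (fun i => 2 * (D i + eta i)).
have r01 i : 0 < 2 * (D i + eta i) <= 1.
  by apply/andP; split; have := D0 i; have := eta0 i; have := D4 i; have := eta4 i; lra.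
split=> //.
- move=> y /AU[i _ Uy]; exists i => //=; rewrite mulrC mulKf//.
  have Ux : U i (xget 0 (U i)) by exact: xgetPex (ex_intro _ _ Uy).
  by rewrite (le_lt_trans (norm_le_diameter (Ud i) Uy Ux))// ltrDl.
move=> n.
have termle i : gauge (2 * (D i + eta i)) <= K * (D i `^ s' + e1 / 2 ^+ i.+1).
  have /andP[r0 r1] := r01 i.
  apply: (le_trans (gC _ r0 r1)); rewrite /K -!mulrA ler_pM2l//.
  have De : 0 <= D i + eta i by rewrite addr_ge0// ltW.
  rewrite powRM// ler_pM2l ?powR_gt0//.
  apply: (le_trans (powRD_le (ltW s'0) (D0 i) (ltW (eta0 i)))).
  by rewrite ler_pM2l ?powR_gt0// lerD2l mulrA; exact: etas.
apply: (@le_trans _ _ (\sum_(i < n) K * (D i `^ s' + e1 / 2 ^+ i.+1))).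
  by apply: ler_sum => i _; exact: termle.
rewrite -mulr_sumr big_split/=.
have dsum : \sum_(i < n) D i `^ s' <= e1.
  rewrite -lee_fin -sumEFin; apply: le_trans (ltW sumU).
  apply: (@le_trans _ _ (\sum_(0 <= i < n) diam_pow s (U i))%E).
    rewrite big_mkord; apply: lee_sum => i _; apply: powR_fine_diameter_le => //.
    by apply: (le_trans (Ud i)); rewrite lee_fin; lra.
  apply: nneseries_lim_ge => i _ _; rewrite /diam_pow; case: ifP => // _.
  exact: poweR_ge0.
have hs := sum_half_le n (ltW e10).
apply: (@le_trans _ _ (K * (2 * e1))); first by rewrite ler_pM2l//; lra.
by rewrite le_eqVlt; apply/orP; left; apply/eqP; rewrite /e1; field; rewrite gt_eqF.
Qed.

Lemma natr_natdist k l : (natdist k l)%:R = `|k%:R - l%:R| :> R.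
Proof.
rewrite /natdist; have [kl|/ltnW kl] := leqP k l.
  by rewrite distrC -natrB// normr_nat (eqP kl).
by rewrite -natrB// normr_nat (eqP kl) addn0.
Qed.

(** Compactness of [[a, b]]: near a zero, a single [V i] contains all points; near any other [t],
    [|g|] stays above [|g t| / 2], so no near zeros remain for large [n]. Positivity of [a] makes
    the zeros in [[a, b]] members of [zero_set g]. *)
Lemma near_zeros_finite_cover (g : R -> R) (a b : R) (V : nat -> set R) : 0 < a ->
    (forall t, a <= t <= b -> {for t, continuous g}) ->
    (forall i, open (V i)) -> zero_set g `<=` \bigcup_i V i ->
  exists n, forall t, a <= t <= b -> `|g t| <= n.+1%:R^-1 ->
    exists2 i, (i < n)%N & V i t.
Proof.
move=> a0 cg oV gV.
have /compact_near_coveringP := @segment_compact R a b.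
move=> /(_ nat \oo (fun n t => `|g t| <= n.+1%:R^-1 -> exists2 i, (i < n)%N & V i t)).
case.
- move=> t; rewrite /= in_itv/= => tab.
  have [gt0|gt0] := eqVneq (g t) 0.
    have [|i _ Vit] := gV t; first by split=> //; move: tab => /andP[? _]; lra.
    exists (V i, [set n | (i < n)%N]); last by move=> [y n] [/= Vy ?] _; exists i.
    split=> /=; first exact: open_nbhs_nbhs.
    exact: nbhs_infty_gt.
  have gp : 0 < `|g t| / 2 by rewrite divr_gt0// normr_gt0.
  have near1 : \forall y \near t, `|g t| / 2 < `|g y|.
    have /cvgrPdist_lt/(_ _ gp) := cg t tab.
    apply: filterS => y h; have := ler_normD (g t - g y) (g y); rewrite subrK; lra.
  have near2 : \forall n \near \oo, n.+1%:R^-1 < `|g t| / 2.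
    exact: near_infty_natSinv_lt (PosNum gp).
  exists ([set y | `|g t| / 2 < `|g y|], [set n | n.+1%:R^-1 < `|g t| / 2]).
    by split.
  move=> [y n] [/= h1 h2] h3; have := lt_trans h2 h1; by rewrite ltNge h3.
move=> n _ h; exists n => t tab gtn; apply: (h n) => //=.
Qed.

(* Cauchy-Schwarz over the pieces of a cover: a cover of small gauge forces a
   large energy. *)
Lemma hausdorff_dim_ge_half (g : R -> R) (c M : R) : 0 < c ->
    (forall t, 1 <= t <= 2 -> {for t, continuous g}) ->
    (forall n, exists m, let N := (m.+1 ^ 2)%N in
      let E k := `|g (1 + k%:R / N%:R)| <= m.+1%:R^-1 in
      [/\ (n <= m)%N, c <= \sum_(k < N | E k) m.+1%:R^-1 &
        \sum_(k < N | E k) \sum_(l < N | E l) N%:R^-1 * kernel N k l <= M]) ->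
  ((2^-1)%:E <= hausdorff_dim (zero_set g))%E.
Proof.
move=> c0 cg hE; apply: le_ereal_inf_tmp => _ [s [s0 Hs] <-].
rewrite lee_fin leNgt; apply/negP => s2.
(* With parameter [2 * x] and total gauge at most [e], [energy_ge_cover] will read
   [2 * (|M| + 1) <= 1 + M], which is absurd. *)
pose x := (`|M| + 1) / (2 * c).
have M1 : 0 < `|M| + 1 by rewrite (lt_le_trans ltr01)// lerDr.
have x0 : 0 < x by rewrite divr_gt0// mulr_gt0.
pose e := (4 * x ^+ 2)^-1.
have e0 : 0 < e by rewrite invr_gt0 mulr_gt0// exprn_gt0.
have [y [r [r01 zcov rsum]]] := hausdorff_null_cover s0 s2 Hs e0.
have oV i : open [set t : R | `|t - y i| < r i / 2].
  rewrite (_ : mkset _ = ball (y i) (r i / 2)); first exact: ball_open.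
  by apply/seteqP; split=> t; rewrite /ball/= distrC.
have [n cov] := near_zeros_finite_cover ltr01 cg oV zcov.
(* Only finitely many intervals matter, so a fine enough grid has mesh below all their lengths,
   which the regularized diagonal of the kernel demands. *)
have : \forall m \near \oo, forall i : 'I_n, m.+1%:R^-1 < r i.
  apply: filter_forall => i; have /andP[ri _] := r01 i.
  exact: near_infty_natSinv_lt (PosNum ri).
move=> [n1 _ n1r].
have [m hm] := hE (maxn n n1).
pose N := (m.+1 ^ 2)%N; pose E (k : nat) := `|g (1 + k%:R / N%:R)| <= m.+1%:R^-1.
have [nm cS FM] : [/\ (maxn n n1 <= m)%N, c <= \sum_(k < N | E k) m.+1%:R^-1 &
  \sum_(k < N | E k) \sum_(l < N | E l) N%:R^-1 * kernel N k l <= M] := hm.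
have m1 : 0 < m.+1%:R :> R by rewrite ltr0n.
have N0 : 0 < N%:R :> R by rewrite ltr0n expn_gt0.
pose idx k : nat := xget 0%N [set i | (i < n)%N /\ `|1 + k%:R / N%:R - y i| < r i / 2].
have idxP k : (k < N)%N -> E k -> (idx k < n)%N /\
    `|1 + k%:R / N%:R - y (idx k)| < r (idx k) / 2.
  move=> kN Ek; rewrite /idx; case: xgetP => [i _ []//|].
  have [| |i ilt Vi] := cov (1 + k%:R / N%:R).
  - rewrite lerDl divr_ge0//= -[2]/(1 + 1) lerD2l ler_pdivrMr// mul1r ler_nat.
    exact: ltnW.
  - apply: (le_trans Ek); rewrite lef_pV2 ?posrE ?ltr0n// ler_nat.
    by move: nm; rewrite geq_max => /andP[].
  - by move=> /(_ i) /(_ (conj ilt Vi)).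
have h : 2 * (2 * x) * (\sum_(k < N | E k) m.+1%:R^-1) <=
    (2 * x) ^+ 2 * (\sum_(j < n) gauge (r j)) +
    \sum_(k < N | E k) \sum_(l < N | E l) N%:R^-1 * kernel N k l.
  apply: (@energy_ge_cover R m.+1 N n E idx) => //.
  - by move=> k kN Ek; have [] := idxP _ kN Ek.
  - move=> j jn; have /andP[_ rj] := r01 j; split=> //.
    have := n1r m; rewrite /= => /(_ _ (Ordinal jn)) /= rm.
    apply: (@le_trans _ _ m.+1%:R^-1).
      by rewrite lef_pV2 ?posrE// ler_nat leq_pmull.
    by apply/ltW/rm; move: nm; rewrite geq_max => /andP[].
  - move=> k l kN lN Ek El ikl.
    have [_ hk] := idxP _ kN Ek; have [_] := idxP _ lN El; rewrite -ikl => hl.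
    have -> : (natdist k l)%:R / N%:R =
        `|(1 + k%:R / N%:R - y (idx k)) - (1 + l%:R / N%:R - y (idx k))| :> R.
      have -> : (1 + k%:R / N%:R - y (idx k)) - (1 + l%:R / N%:R - y (idx k)) =
          (k%:R - l%:R) / N%:R by ring.
      rewrite normrM [`|_^-1|]gtr0_norm ?invr_gt0//; congr (_ / _).
      exact: natr_natdist.
    by apply: (le_trans (ler_normB _ _)); lra.
have : 2 * (2 * x) * c <= (2 * x) ^+ 2 * e + M.
  apply: (@le_trans _ _ (2 * (2 * x) * (\sum_(k < N | E k) m.+1%:R^-1))).
    by rewrite ler_pM2l// mulr_gt0// mulr_gt0.
  by apply: (le_trans h); rewrite lerD// ler_wpM2l// sqr_ge0.
have -> : 2 * (2 * x) * c = 2 * (`|M| + 1) by rewrite /x; field; rewrite gt_eqF.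
have -> : (2 * x) ^+ 2 * e = 1 by rewrite /e; field; rewrite gt_eqF.
have := ler_norm M; have := normr_ge0 M; lra.
Qed.

End Dimension.

Theorem theorem1p5 (R : realType) (d : measure_display) (T : measurableType d)
    (P : probability T R) (B : R -> {RV P >-> R}) (hB : brownian_motion B)
    (f : R -> R) (hf : {within `[0, +oo[%classic, continuous f}) :
  with_positive_probability P
    [set w : T |
      ((2^-1)%:E <= hausdorff_dim (zero_set (fun t : R => (B t w - f t)%R)))%E].
Proof.
have cont0 (h : R -> R) : {within `[0, +oo[%classic, continuous h} ->
    forall t, 1 <= t <= 2 -> {for t, continuous h}.
  move=> /continuous_within_itvcyP[ch _] t /andP[t1 _]; apply: ch.
  by rewrite in_itv/= andbT; lra.
have [u _ fu] : exists2 u, u \in `[1, 2]%R &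
    forall t, t \in `[1, 2]%R -> `|f t| <= `|f u|.
  apply: (@EVT_max _ (fun t => `|f t|)); first lra.
  apply: continuous_in_subspaceT => t; rewrite inE/= in_itv/= => t12.
  by apply: cvg_norm; exact: cont0.
have fM t : 1 <= t <= 2 -> `|f t| + 1 <= `|f u| + 1.
  by move=> t12; rewrite lerD2r fu// in_itv.
have [c [M [e [c0 e0 eP]]]] := near_zero_energy_event hB fM.
(* The shift to [m.+1] avoids the degenerate grid at 0; the limsup of the [G m] is the event that
   good grids occur infinitely often. *)
pose G m := energy_event m.+1 (m.+1 ^ 2) (near_zero B f m.+1) c M.
have mG m : measurable (G m).
  by apply: measurable_energy_event => k; exact: measurable_increment_near.
(* Off the null set [Z] the path is continuous and starts at 0, so [near_zero] really compares [B]
   with [f]; removing [Z] costs no probability. *)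
have [Z [mZ Z0 hZ]] := negligibleU (bm_start hB) (bm_cont hB).
have mL : measurable (lim_sup_set G).
  by apply: bigcap_measurable => // n _; exact: bigcup_measurable.
exists (lim_sup_set G `\` Z); split; first exact: measurableD.
- move=> w [Gw Zw].
  have [B0 cB] : B 0 w = 0 /\ {within `[0, +oo[%classic, continuous (fun t : R => B t w)}.
    by split; apply: contrapT => h; apply: Zw; apply: hZ; [left|right].
  apply: (@hausdorff_dim_ge_half _ _ c M) => //.
    by move=> t t12; apply: cvgB; exact: cont0.
  move=> n; have [m /= nm [hS hF]] := Gw n I; exists m.
  pose N := (m.+1 ^ 2)%N.
  pose E (k : nat) := `|B (1 + k%:R / N%:R) w - f (1 + k%:R / N%:R)| <= m.+1%:R^-1.
  rewrite -/N; change [/\ (n <= m)%N, c <= \sum_(k < N | E k) m.+1%:R^-1 &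
    \sum_(k < N | E k) \sum_(l < N | E l) N%:R^-1 * kernel N k l <= M].
  have EE k : \1_(near_zero B f m.+1 k) w = (E k)%:R :> R.
    rewrite indicE; congr (_%:R); congr nat_of_bool; apply/idP/idP.
      by rewrite inE /near_zero increment_nearE B0 subr0.
    by move=> Ek; rewrite inE /near_zero increment_nearE B0 subr0.
  split=> //.
  + apply: (le_trans hS); rewrite /occupation [leRHS]big_mkcond/=.
    by apply: ler_sum => k _; rewrite EE; case: (E k); rewrite ?mulr1 ?mulr0.
  + apply: le_trans hF; rewrite /energy [leLHS]big_mkcond/=; apply: ler_sum => k _.
    rewrite EE; case: (E k) => /=; last by rewrite big1// => l _; rewrite mul0r mulr0.
    rewrite [leLHS]big_mkcond/=; apply: ler_sum => l _.
    by rewrite EE mul1r; case: (E l); rewrite ?mulr1 ?mulr0.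
- apply: (@lt_le_trans _ _ (P (lim_sup_set G))).
    apply: (@lt_le_trans _ _ e%:E); first by rewrite lte_fin.
    by apply: prob_lim_sup_set_ge => // n; exact: eP.
  rewrite -[leRHS]adde0 -Z0.
  apply: le_trans (measureU2 _ _ _) => //; last exact: measurableD.
  apply: le_measure; rewrite ?inE//; first by apply: measurableU => //; exact: measurableD.
  by move=> w Gw; have [Zw|Zw] := pselect (Z w); [right|left].
Qed.
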